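(* Let $G=(V,E)$ be a graph with $n$ nodes, with distances $d$ and service demand $w$, and let $k<n$ be a positive integer. Let $\hat{S}=\{\hat{s}_1,\dots,\hat{s}_k\}\subset V$ be an optimal data center placement, i.e. a set of $k$ nodes with $$\hat{S}\in\arg\min_{S\subset V,\ |S|=k}\ \sum_{v\in V} w(v)\,d(s(v;S),v),$$ where $s(v;S)\in\arg\min_{s\in S} d(s,v)$. Then the Voronoi partition $\{V_i\}_{i=1}^k$ of $G$ corresponding to the generators $\hat{S}$ is a centroidal Voronoi partition of $G$; that is, for every $i=1,\dots,k$, the generator $\hat{s}_i$ is a cost center of its own Voronoi region: $$\hat{s}_i\in\arg\min_{s\in V_i}\ \sum_{v\in V_i} w(v)\,d(s,v).$$
   Context: $G=(V,E)$ is a graph, directed or undirected, with $|V|=n$. Each node $v\in V$ has a non-negative weight $w(v)$ (its service demand). Each edge $(u,v)\in E$ has a non-negative distance $d(u,v)$. For distinct nodes $u,v$, $d(u,v)$ denotes the distance of a shortest path from $u$ to $v$ in $G$, i.e. the sum of the edge distances along this path. The value $d(v,v)\ge 0$ is also given and is allowed to be nonzero (a local cost of choosing $v$ as a data center), even though there is no edge from $v$ to itself. For a set $S\subset V$ of nodes on which data centers are placed, every node $v$ is served solely by a data center $s(v;S)\in\arg\min_{s\in S}d(s,v)$, and the overall weighted cost of serving $V$ by $S$ is $\mathrm{cost}(S\mid G)=\sum_{v\in V}w(v)d(s(v;S),v)$. For a region $\tilde V\subset V$, a cost center of $\tilde V$ is a node in $\arg\min_{s\in\tilde V}\mathrm{cost}(s\mid\tilde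 V)$, where $\mathrm{cost}(s\mid\tilde V)=\sum_{v\in\tilde V}w(v)d(s,v)$. Given $S=\{s_1,\dots,s_k\}\subset V$ (the generators), the Voronoi region of $s_i$ is $V_i=\{v\in V : d(s_i,v)\le d(s_j,v)\text{ for } j=1,\dots,k,\ j\ne i\}$, and $\{V_i\}_{i=1}^k$ is called the Voronoi partition of $G$ corresponding to $S$. It is a centroidal Voronoi partition if the generators are simultaneously the cost centers of the regions.
   Formalization: Since d(v,v) may be positive, a generator can lie outside its own Voronoi region, so the claim can fail as stated; proved: the cost inequality against every node of the region always, and the centroidal property when every generator lies in its own region. *)

(* Defs.v *)
From HB Require Import structures.
From mathcomp Require Import all_boot all_order all_algebra.
From mathcomp Require Import classical_sets reals constructive_ereal ereal.

Set Implicit Arguments.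
Unset Strict Implicit.
Unset Printing Implicit Defensive.

Import Order.TTheory GRing.Theory Num.Theory.
Local Open Scope ring_scope.
Local Open Scope ereal_scope.

(* Edges are directed; an undirected graph is one whose [edge] and [edge_dist]
   are symmetric.  [edge_dist] is only meaningful on edges, and [local_cost v]
   is the prescribed value d(v,v). *)
Record network (R : realType) (V : finType) := Network {
  edge : rel V;
  edge_irrefl : irreflexive edge;
  edge_dist : V -> V -> R;
  edge_dist_ge0 : forall u v, edge u v -> (0 <= edge_dist u v)%R;
  local_cost : V -> R;
  local_cost_ge0 : forall v, (0 <= local_cost v)%R;
  demand : V -> R;
  demand_ge0 : forall v, (0 <= demand v)%R
}.

Section Network.
Variables (R : realType) (V : finType) (G : network R V).

Definition path_length (u : V) (p : seq V) : R :=
  (\sum_(e <- zip (u :: p) p) edge_dist G e.1 e.2)%R.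

(* For u <> v the infimum ranges over the finitely many simple paths from u to
   v, so it is the length of a shortest path, or +oo if v is unreachable from u
   (the graph is not assumed to be connected). *)
Definition dist (u v : V) : \bar R :=
  if u == v then (local_cost G v)%:E
  else ereal_inf [set x : \bar R | exists p : seq V,
         [/\ path (edge G) u p, uniq (u :: p), last u p = v
           & x = (path_length u p)%:E]]%classic.

(* [s S v] is the data center s(v;S); ties are broken arbitrarily. *)
Definition server_choice (s : {set V} -> V -> V) : Prop :=
  forall (S : {set V}) (v : V), S != finset.set0 ->
    s S v \in S /\ (forall t, t \in S -> dist (s S v) v <= dist t v).

(* Products follow the convention 0 * +oo = 0. *)
Definition serving_cost (s : {set V} -> V -> V) (S : {set V}) : \bar R :=
  \sum_(v : V) (demand G v)%:E * dist (s S v) v.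

Definition optimal_placement (s : {set V} -> V -> V) (k : nat) (S : {set V}) :
    Prop :=
  #|S| = k /\
  (forall T : {set V}, #|T| = k -> serving_cost s S <= serving_cost s T).

Definition region_cost (U : {set V}) (t : V) : \bar R :=
  \sum_(v in U) (demand G v)%:E * dist t v.

Definition cost_center (U : {set V}) (c : V) : Prop :=
  c \in U /\ (forall t, t \in U -> region_cost U c <= region_cost U t).

(* Ties put a node in several regions.  Since d(v,v) need not be 0, a generator
   can lie outside its own region. *)
Definition voronoi_region (k : nat) (gen : 'I_k -> V) (i : 'I_k) : {set V} :=
  [set v : V | [forall j, (j != i) ==> (dist (gen i) v <= dist (gen j) v)]]%SET.

Definition centroidal_voronoi (k : nat) (gen : 'I_k -> V) : Prop :=
  forall i : 'I_k, cost_center (voronoi_region gen i) (gen i).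

End Network.

(* Main.v *)
(* Replacing the generator c of a region U by a non-generator t in U gives
   another k-element placement T.  Serving U from t and every other node as
   before costs at least cost(T), hence at least the optimal cost; cancelling
   the nodes outside U leaves the comparison of c with t on U.  The cancelled
   sum is finite even when some nodes are unreachable: a node outside U is
   strictly closer to another generator than to c, so its serving distance is
   below +oo. *)

Require Import Defs.
From HB Require Import structures.
From mathcomp Require Import all_boot all_order all_algebra.
From mathcomp Require Import classical_sets reals constructive_ereal ereal.

Set Implicit Arguments.
Unset Strict Implicit.
Unset Printing Implicit Defensive.

Import Order.TTheory GRing.Theory Num.Theory.

Lemma path_length_ge0 (R : realType) (V : finType) (G : network R V)
    (u : V) (p : seq V) :
  path (edge G) u p -> (0 <= path_length G u p)%R.
Proof.
rewrite /path_length; elim: p u => [|v p IHp] u /=; first by rewrite big_nil.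
by move=> /andP[uv vp]; rewrite big_cons addr_ge0 ?edge_dist_ge0 ?IHp.
Qed.

Lemma dist_ge0 (R : realType) (V : finType) (G : network R V) (u v : V) :
  (0 <= dist G u v)%E.
Proof.
rewrite /dist; case: ifP => _; first by rewrite lee_fin local_cost_ge0.
apply: le_ereal_inf_tmp => _ [p [uvp _ _ ->]].
by rewrite lee_fin path_length_ge0.
Qed.

Lemma not_voronoi_region (R : realType) (V : finType) (G : network R V)
    (k : nat) (gen : 'I_k -> V) (i : 'I_k) (v : V) :
  v \notin voronoi_region G gen i ->
  exists j, (dist G (gen j) v < dist G (gen i) v)%E.
Proof.
rewrite inE negb_forall => /existsP[j].
by rewrite negb_imply -ltNge => /andP[_ lt_ji]; exists j.
Qed.

Lemma voronoi_region_le (R : realType) (V : finType) (G : network R V)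
    (k : nat) (gen : 'I_k -> V) (i j : 'I_k) (v : V) :
  v \in voronoi_region G gen i -> (dist G (gen i) v <= dist G (gen j) v)%E.
Proof.
rewrite inE => /forallP/(_ j)/implyP le_ij.
by have [->|/le_ij] := eqVneq j i.
Qed.

Lemma serving_costID (R : realType) (V : finType) (G : network R V)
    (s : {set V} -> V -> V) (S U : {set V}) :
  serving_cost G s S =
  (\sum_(v in U) (demand G v)%:E * dist G (s S v) v
   + \sum_(v | v \notin U) (demand G v)%:E * dist G (s S v) v)%E.
Proof. by rewrite /serving_cost (bigID (mem U)). Qed.

Lemma region_cost_generator_le (R : realType) (V : finType) (G : network R V)
    (s : {set V} -> V -> V) (hs : server_choice G s) (k : nat)
    (gen : 'I_k -> V)
    (hopt : optimal_placement G s k [set gen i | i : 'I_k]%SET)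
    (i : 'I_k) (t : V) :
  (region_cost G (voronoi_region G gen i) (gen i)
     <= region_cost G (voronoi_region G gen i) t)%E.
Proof.
set U := voronoi_region G gen i; case: hopt.
set S := [set gen j | j : 'I_k]%SET => cardS minS.
have genS j : gen j \in S by apply: imset_f.
have demandM v (x y : \bar R) : (x <= y)%E ->
    ((demand G v)%:E * x <= (demand G v)%:E * y)%E.
  by move=> le_xy; apply: lee_wpmul2l => //; rewrite lee_fin demand_ge0.
(* When [t] is already a generator, the swap would lose a point; the inequality then holds term by
   term, by definition of the region. *)
have [/imsetP[j _ ->]|tNS] := boolP (t \in S).
  by apply: lee_sum => v Uv; apply: demandM; apply: voronoi_region_le.
have S0 : S != finset.set0 by apply/set0Pn; exists (gen i).
pose T := (t |: S :\ gen i)%SET.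
have tT : t \in T by rewrite setU11.
have T0 : T != finset.set0 by apply/set0Pn; exists t.
have cardT : #|T| = k.
  rewrite cardsU1 in_setD1 (negPf tNS) andbF /=.
  by rewrite -cardS (cardsD1 (gen i) S) genS.
(* Strictness serves twice: it makes [rest] finite, and it shows that [v] is not served by [gen i],
   so its server survives in [T]. *)
have server_lt v : v \notin U -> (dist G (s S v) v < dist G (gen i) v)%E.
  move=> /not_voronoi_region[j lt_ji]; apply: le_lt_trans lt_ji.
  by have [_ ->] := hs S v S0.
pose rest := (\sum_(v | v \notin U) (demand G v)%:E * dist G (s S v) v)%E.
have rest_fin : rest \is a fin_num.
  apply/sum_fin_numP => v _ vNU; apply: fin_numM => //.
  by rewrite ge0_fin_numE ?dist_ge0 // (lt_le_trans (server_lt v vNU)) ?leey.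
rewrite -(leeD2rE _ _ rest_fin).
(* The server of a node of [U] is some generator, hence no closer than [gen i]. *)
have leS : (region_cost G U (gen i) + rest <= serving_cost G s S)%E.
  rewrite (serving_costID _ _ _ U); apply: leeD => //.
  apply: lee_sum => v Uv; apply: demandM.
  have [/imsetP[j _ ->] _] := hs S v S0.
  exact: voronoi_region_le.
apply: le_trans leS (le_trans (minS T cardT) _).
rewrite (serving_costID _ _ _ U); apply: leeD; apply: lee_sum => v vU;
  apply: demandM; have [_ -> //] := hs T v T0.
(* What remains is that the old server of a node outside [U] belongs to [T], i.e. differs from
   [gen i]. *)
rewrite !inE; apply/orP; right; have [-> _] := hs S v S0; rewrite andbT.
by apply: contraTneq (server_lt v vU) => ->; rewrite ltxx.
Qed.

(** A positive local cost can put a generator outside its own region. Minimality is therefore stated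
    unconditionally, and membership is assumed only to conclude that the partition is centroidal. *)
Theorem lemma1 (R : realType) (V : finType) (G : network R V)
    (s : {set V} -> V -> V) (hs : server_choice G s)
    (k : nat) (hk0 : 0 < k) (hkn : k < #|V|)
    (Shat : {set V}) (hopt : optimal_placement G s k Shat)
    (gen : 'I_k -> V) (hgen : Shat = [set gen i | i : 'I_k]%SET) :
  (forall (i : 'I_k) (t : V), t \in voronoi_region G gen i ->
     (region_cost G (voronoi_region G gen i) (gen i)
        <= region_cost G (voronoi_region G gen i) t)%E)
  /\ ((forall i : 'I_k, gen i \in voronoi_region G gen i) ->
      centroidal_voronoi G gen).
Proof.
rewrite hgen in hopt.
split=> [i t _|genU i]; first exact: (region_cost_generator_le hs).
by split=> // t _; apply: (region_cost_generator_le hs).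
Qed.
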